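(* Let $\mathscr{H}$ be a complex Hilbert space. For every unitarily invariant norm $|||\cdot|||$, every invertible $S\in\mathbb{B}(\mathscr{H})$ and all $X,Y\in\mathfrak{J}_{|||\cdot|||}$, the following inequalities hold: (i) $\left|\left|\left|\left(SYS^{-1}+(S^* )^{-1}YS^*\right)\oplus\left(S^*X(S^* )^{-1}+S^{-1}XS\right)\right|\right|\right|\ \ge\ 2\,|||X\oplus Y|||$; (ii) $\left|\left|\left|\left(SY(S^* )^{-1}+(S^* )^{-1}YS\right)\oplus\left(S^*XS^{-1}+S^{-1}XS^*\right)\right|\right|\right|\ \ge\ 2\,|||X\oplus Y|||$. Moreover, each of (i) and (ii) (asserted for all unitarily invariant norms, all invertible $S$ and all $X,Y\in\mathfrak{J}_{|||\cdot|||}$) is equivalent to the Corach--Porta--Recht inequality for unitarily invariant norms, i.e. to the assertion that for every unitarily invariant norm $|||\cdot|||$, every invertible self-adjoint $S\in\mathbb{B}(\mathscr{H})$ and every $X\in\mathfrak{J}_{|||\cdot|||}$, $$|||SXS^{-1}+S^{-1}XS|||\ge 2\,|||X|||.$$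
   Context: $\mathbb{B}(\mathscr{H})$ is the algebra of bounded linear operators on $\mathscr{H}$. A unitarily invariant norm $|||\cdot|||$ is a norm defined on an associated norm ideal $\mathfrak{J}_{|||\cdot|||}$ of $\mathbb{B}(\mathscr{H})$ (in the usual sense: a two-sided ideal, complete in $|||\cdot|||$) such that $|||UXV|||=|||X|||$ for all unitaries $U,V$ and all $X\in\mathfrak{J}_{|||\cdot|||}$; examples are the operator norm (with ideal $\mathbb{B}(\mathscr{H})$) and the Schatten $p$-norms. For $A,B\in\mathbb{B}(\mathscr{H})$, $A\oplus B$ denotes the block-diagonal operator $\begin{bmatrix}A&0\\0&B\end{bmatrix}$ on $\mathscr{H}\oplus\mathscr{H}$; as usual, such a norm is regarded as depending only on singular values (a symmetric gauge function of them), so that the same symbol $|||\cdot|||$ also denotes the corresponding unitarily invariant norm for operators on $\mathscr{H}\oplus\mathscr{H}$. *)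

(* Defs.v *)
From HB Require Import structures.
From mathcomp Require Import all_boot all_order all_algebra.
From mathcomp Require Import all_classical all_reals all_analysis.
From mathcomp Require Import complex.
From mathcomp Require Import ring.

Set Implicit Arguments.
Unset Strict Implicit.
Unset Printing Implicit Defensive.

Import Order.TTheory GRing.Theory Num.Theory.
Import numFieldNormedType.Exports.

Local Open Scope classical_set_scope.
Local Open Scope ring_scope.
Local Open Scope complex_scope.

(* The inner product is linear in its first argument. *)
HB.mixin Record CompleteNormedModule_isHilbert (R : realType) H
    & @CompleteNormedModule R[i] H := {
  hdot : {dot H for (@Num.conj R[i])};
  hdot_norm : forall x : H, `|x| ^+ 2 = hdot x x
}.

#[short(type="hilbertType")]
HB.structure Definition Hilbert (R : realType) :=
  {H of @CompleteNormedModule R[i] H & CompleteNormedModule_isHilbert R H}.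

Section HilbertSum.
Variables (R : realType) (H : hilbertType R).
Local Notation C := R[i].

(* The product type carries the sup norm in the library, hence the alias. *)
Definition hsum : Type := (H * H)%type.

HB.instance Definition _ := GRing.Lmodule.copy hsum (H * H)%type.

Definition hsum_dot (u v : hsum) : C := hdot u.1 v.1 + hdot u.2 v.2.

Definition hsum_norm (u : hsum) : C := sqrtC (`|u.1| ^+ 2 + `|u.2| ^+ 2).

Lemma hsum_dot_bilinear :
  bilinear_for *%R (@Num.conj C \; *%R) hsum_dot.
Proof.
split=> [v a u w | u a v w]; rewrite /hsum_dot.
  by rewrite !linearDl !linearZl_LR -addrACA -mulrDr.
by rewrite !linearDr !linearZr_LR -addrACA -mulrDr.
Qed.

HB.instance Definition _ := bilinear_isBilinear.Build C hsum hsum C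
  *%R (@Num.conj C \; *%R) hsum_dot hsum_dot_bilinear.

Lemma hsum_dotC u v : hsum_dot u v = (-1) ^+ false * (hsum_dot v u)^*.
Proof. by rewrite /hsum_dot rmorphD mulrDr -!hermC. Qed.

HB.instance Definition _ := isHermitianSesquilinear.Build C hsum false
  (@Num.conj C) hsum_dot hsum_dotC.

Lemma hsum_dot_gt0 u : u != 0 -> 0 < hsum_dot u u.
Proof.
case: u => x y; rewrite /hsum_dot/= => xy0.
have [x0|x0] := eqVneq x 0.
  rewrite ltr_wpDl// dnorm_gt0; apply: contra xy0 => /eqP ->.
  by rewrite x0.
by rewrite ltr_pwDl// dnorm_gt0.
Qed.

HB.instance Definition _ := isDotProduct.Build C hsum hsum_dot hsum_dot_gt0.

Lemma hsum_norm_ge0 u : 0 <= hsum_norm u.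
Proof. by rewrite sqrtC_ge0 addr_ge0 ?exprn_ge0. Qed.

Lemma hsum_normD u v : hsum_norm (u + v) <= hsum_norm u + hsum_norm v.
Proof.
have minkowski (a b c d : C) : 0 <= a -> 0 <= b -> 0 <= c -> 0 <= d ->
    sqrtC ((a + c) ^+ 2 + (b + d) ^+ 2) <=
    sqrtC (a ^+ 2 + b ^+ 2) + sqrtC (c ^+ 2 + d ^+ 2).
  move=> a0 b0 c0 d0.
  have p0 : 0 <= a ^+ 2 + b ^+ 2 by rewrite addr_ge0 ?exprn_ge0.
  have q0 : 0 <= c ^+ 2 + d ^+ 2 by rewrite addr_ge0 ?exprn_ge0.
  have r0 : 0 <= (a + c) ^+ 2 + (b + d) ^+ 2.
    by rewrite addr_ge0 ?exprn_ge0 ?addr_ge0.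
  rewrite -(@ler_pXn2r _ 2 isT) ?nnegrE ?addr_ge0 ?sqrtC_ge0//.
  rewrite sqrtCK [leRHS]sqrrD !sqrtCK -sqrtCM ?nnegrE//.
  suff cs : a * c + b * d <= sqrtC ((a ^+ 2 + b ^+ 2) * (c ^+ 2 + d ^+ 2)).
    apply: (@le_trans _ _ ((a ^+ 2 + b ^+ 2) + (a * c + b * d) *+ 2
                           + (c ^+ 2 + d ^+ 2))).
      by rewrite le_eqVlt; apply/orP; left; apply/eqP; ring.
    by rewrite lerD2r lerD2l lerMn2r cs orbT.
  rewrite -(@ler_pXn2r _ 2 isT) ?nnegrE ?sqrtC_ge0 ?mulr_ge0//; last first.
    by rewrite addr_ge0 ?mulr_ge0.
  rewrite sqrtCK -subr_ge0.
  have -> : (a ^+ 2 + b ^+ 2) * (c ^+ 2 + d ^+ 2) - (a * c + b * d) ^+ 2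
            = (a * d - b * c) ^+ 2 by ring.
  by rewrite -realEsqr rpredB// ger0_real// mulr_ge0.
apply: le_trans (minkowski _ _ _ _ _ _ _ _) => //.
rewrite ler_sqrtC ?nnegrE ?addr_ge0 ?exprn_ge0 ?addr_ge0//.
by rewrite lerD// lerXn2r ?nnegrE ?addr_ge0//; exact: ler_normD.
Qed.

Lemma hsum_normZ a u : hsum_norm (a *: u) = `|a| * hsum_norm u.
Proof.
rewrite /hsum_norm !normrZ !exprMn -mulrDr sqrtCM ?nnegrE ?exprn_ge0//.
by rewrite sqrCK.
Qed.

Lemma hsum_norm_eq0 u : hsum_norm u = 0 -> u = 0.
Proof.
move/eqP; rewrite sqrtC_eq0 paddr_eq0 ?exprn_ge0// !expf_eq0/= !normr_eq0.
by case: u => x y /= /andP[/eqP -> /eqP ->].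
Qed.

HB.instance Definition _ := @Lmodule_isNormed.Build C hsum hsum_norm
  hsum_normD hsum_normZ hsum_norm_eq0.

Lemma hsum_norm_fst (u : hsum) : `|u.1| <= `|u|.
Proof.
rewrite -(@ler_pXn2r _ 2 isT) ?nnegrE// [X in _ <= X]sqrtCK.
by rewrite lerDl exprn_ge0.
Qed.

Lemma hsum_norm_snd (u : hsum) : `|u.2| <= `|u|.
Proof.
rewrite -(@ler_pXn2r _ 2 isT) ?nnegrE// [X in _ <= X]sqrtCK.
by rewrite lerDr exprn_ge0.
Qed.

Lemma hsum_norm_le (u : hsum) : `|u| <= `|u.1| + `|u.2|.
Proof.
rewrite -(@ler_pXn2r _ 2 isT) ?nnegrE// ?addr_ge0// [X in X <= _]sqrtCK.
by rewrite sqrrD addrAC lerDl mulrn_wge0// mulr_ge0.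
Qed.

Lemma hsum_complete (F : set_system hsum) :
  ProperFilter F -> cauchy F -> cvg F.
Proof.
move=> FF /cauchy_ballP Fc.
have proj (p : hsum -> H) : {morph p : x y / x - y} ->
    (forall u, `|p u| <= `|u|) -> cvg (p @ F).
  move=> pB ple; apply: cauchy_cvg; apply/cauchy_ballP => e e0.
  rewrite near_simpl; have := Fc e e0.
  apply: filterS => -[x y]; rewrite -!ball_normE /ball_/= => xye.
  by rewrite -pB; exact: le_lt_trans xye.
have /cvg_ex[x Fx] := proj fst (fun _ _ => erefl) hsum_norm_fst.
have /cvg_ex[y Fy] := proj snd (fun _ _ => erefl) hsum_norm_snd.
apply/cvg_ex; exists ((x, y) : hsum); apply/cvgrPdist_lt => e e0.
have e20 : 0 < e / 2 by rewrite divr_gt0.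
move/cvgrPdist_lt : Fx => /(_ _ e20) Fx; move/cvgrPdist_lt : Fy => /(_ _ e20) Fy.
near=> u; apply: le_lt_trans (hsum_norm_le _) _; rewrite [e]splitr ltrD//=.
- by near: u.
- by near: u.
Unshelve. all: by end_near. Qed.

HB.instance Definition _ := Uniform_isComplete.Build hsum hsum_complete.

Lemma hsum_dot_norm (u : hsum) : `|u| ^+ 2 = hsum_dot u u.
Proof. by rewrite [LHS]sqrtCK /hsum_dot !hdot_norm. Qed.

HB.instance Definition _ := CompleteNormedModule_isHilbert.Build R hsum
  hsum_dot_norm.

End HilbertSum.

Section BoundedOperators.
Variables (R : realType) (H : hilbertType R).
Local Notation C := R[i].

Definition bounded_op (f : H -> H) := exists M : C, forall x, `|f x| <= M * `|x|.

(* The algebra B(H). *)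
Record bop := Bop { bop_fun :> {linear H -> H}; bopP : bounded_op bop_fun }.

Lemma bop_ext (S T : bop) : S =1 T -> S = T.
Proof.
case: S T => [S hS] [T hT] /= ST.
have E : S = T.
  case: S T ST {hS hT} => [S cS] [T cT] /= /funext ST.
  case: _ / ST cT => -[[aT] [sT]]; case: cS => -[aS] [sS].
  by rewrite (Prop_irrelevance aS aT) (Prop_irrelevance sS sT).
by case: _ / E hT => hT; congr Bop; exact: Prop_irrelevance.
Qed.

Lemma bounded_op_zero : bounded_op (\0 : H -> H).
Proof. by exists 0 => x /=; rewrite normr0 mul0r. Qed.

Lemma bounded_op_add (S T : bop) : bounded_op (S \+ T).
Proof.
case: (bopP S) (bopP T) => [M hM] [N hN]; exists (M + N) => x /=.
by rewrite mulrDl (le_trans (ler_normD _ _))// lerD.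
Qed.

Lemma bounded_op_scale (a : C) (S : bop) : bounded_op (a \*: S).
Proof.
case: (bopP S) => M hM; exists (`|a| * M) => x /=.
by rewrite normrZ -mulrA ler_wpM2l.
Qed.

Lemma bounded_op_opp (S : bop) : bounded_op (\- S).
Proof. by case: (bopP S) => M hM; exists M => x /=; rewrite normrN. Qed.

Lemma bounded_op_id : bounded_op (idfun : H -> H).
Proof. by exists 1 => x /=; rewrite mul1r. Qed.

Lemma bounded_op_comp (S T : bop) : bounded_op (S \o T).
Proof.
case: (bopP S) (bopP T) => [M hM] [N hN]; exists (`|M| * `|N|) => x /=.
apply: (le_trans (hM _)); apply: (@le_trans _ _ (`|M| * `|T x|)).
  have [->|Tx0] := eqVneq (T x) 0; first by rewrite normr0 !mulr0.
  rewrite ler_wpM2r// ger0_norm//.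
  have /(le_trans (normr_ge0 _)) := hM (T x).
  by rewrite pmulr_lge0// normr_gt0.
rewrite -mulrA ler_wpM2l//; apply: (le_trans (hN _)).
have [->|x0] := eqVneq x 0; first by rewrite normr0 !mulr0.
rewrite ler_wpM2r// ger0_norm//.
by have /(le_trans (normr_ge0 _)) := hN x; rewrite pmulr_lge0// normr_gt0.
Qed.

Definition bop_zero := Bop bounded_op_zero.
Definition bop_add S T := Bop (bounded_op_add S T).
Definition bop_opp S := Bop (bounded_op_opp S).
Definition bop_scale a S := Bop (bounded_op_scale a S).
Definition bop_id := Bop bounded_op_id.
Definition bop_comp S T := Bop (bounded_op_comp S T).

HB.instance Definition _ := gen_eqMixin bop.
HB.instance Definition _ := gen_choiceMixin bop.

Lemma bop_addA : associative bop_add.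
Proof. by move=> S T U; apply: bop_ext => x /=; rewrite addrA. Qed.
Lemma bop_addC : commutative bop_add.
Proof. by move=> S T; apply: bop_ext => x /=; rewrite addrC. Qed.
Lemma bop_add0 : left_id bop_zero bop_add.
Proof. by move=> S; apply: bop_ext => x /=; rewrite add0r. Qed.
Lemma bop_addN : left_inverse bop_zero bop_opp bop_add.
Proof. by move=> S; apply: bop_ext => x /=; rewrite addNr. Qed.

HB.instance Definition _ :=
  GRing.isZmodule.Build bop bop_addA bop_addC bop_add0 bop_addN.

Lemma bop_compA : associative bop_comp.
Proof. by move=> S T U; exact: bop_ext. Qed.
Lemma bop_comp1l : left_id bop_id bop_comp.
Proof. by move=> S; exact: bop_ext. Qed.
Lemma bop_comp1r : right_id bop_id bop_comp.
Proof. by move=> S; exact: bop_ext. Qed.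
Lemma bop_compDl : left_distributive bop_comp bop_add.
Proof. by move=> S T U; exact: bop_ext. Qed.
Lemma bop_compDr : right_distributive bop_comp bop_add.
Proof. by move=> S T U; apply: bop_ext => x /=; rewrite linearD. Qed.

(* Multiplication is composition; B(H) is the zero ring when H = 0. *)
HB.instance Definition _ := GRing.Zmodule_isPzRing.Build bop
  bop_compA bop_comp1l bop_comp1r bop_compDl bop_compDr.

Lemma bop_scaleA a b S : bop_scale a (bop_scale b S) = bop_scale (a * b) S.
Proof. by apply: bop_ext => x /=; rewrite scalerA. Qed.
Lemma bop_scale1 : left_id 1 bop_scale.
Proof. by move=> S; apply: bop_ext => x /=; rewrite scale1r. Qed.
Lemma bop_scaleDr : right_distributive bop_scale bop_add.
Proof. by move=> a S T; apply: bop_ext => x /=; rewrite scalerDr. Qed.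
Lemma bop_scaleDl S : {morph bop_scale^~ S : a b / a + b}.
Proof. by move=> a b; apply: bop_ext => x /=; rewrite scalerDl. Qed.

HB.instance Definition _ := GRing.Zmodule_isLmodule.Build C bop
  bop_scaleA bop_scale1 bop_scaleDr bop_scaleDl.

Definition opnorm (T : bop) : R :=
  sup [set complex.Re `|T x| | x in [set x : H | `|x| <= 1]].

Definition rank_le (n : nat) (F : bop) :=
  exists v : 'I_n -> H, forall x, exists c : 'I_n -> C,
    F x = \sum_(i < n) c i *: v i.

(* The singular values of T, counted with multiplicity in decreasing order
   and indexed from 0, in the form of approximation numbers; this makes sense
   for every bounded operator and gives the eigenvalues of |T|, padded with
   zeros, when T is compact. *)
Definition singular_value (T : bop) (n : nat) : R :=
  inf [set opnorm (T - F) | F in rank_le n].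

Definition is_adjoint (S T : bop) := forall x y, hdot (S x) y = hdot x (T y).

(* The adjoint exists by the Riesz representation theorem and is unique. *)
Definition adjoint (S : bop) : bop := xget 0 [set T | is_adjoint S T].

Definition selfadjoint (S : bop) := adjoint S = S.

Definition unitary (U : bop) := adjoint U * U = 1 /\ U * adjoint U = 1.

Definition is_inverse (S T : bop) := S * T = 1 /\ T * S = 1.

Definition invertible (S : bop) := exists T, is_inverse S T.

Definition inverse (S : bop) : bop := xget 0 [set T | is_inverse S T].

End BoundedOperators.

Section BlockOperators.
Variables (R : realType) (H : hilbertType R).
Local Notation C := R[i].
Variables A B D E : bop H.

Definition block_fun (u : hsum H) : hsum H :=
  (A u.1 + B u.2, D u.1 + E u.2).

Lemma block_fun_linear : linear block_fun.
Proof.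
move=> a u v; apply: injective_projections.
  by rewrite /= !linearD !linearZ/= addrACA -scalerDr.
by rewrite /= !linearD !linearZ/= addrACA -scalerDr.
Qed.

HB.instance Definition _ :=
  GRing.isLinear.Build C (hsum H) (hsum H) _ block_fun block_fun_linear.

Lemma bounded_op_block : bounded_op block_fun.
Proof.
have ge0_bound (T : bop H) :
    exists2 M : C, 0 <= M & forall x, `|T x| <= M * `|x|.
  case: (bopP T) => M hM; exists `|M| => // x.
  have [->|x0] := eqVneq x 0; first by rewrite linear0 normr0 mulr0.
  have M0 : 0 <= M.
    by have /(le_trans (normr_ge0 _)) := hM x; rewrite pmulr_lge0// normr_gt0.
  by rewrite ger0_norm.
have [a a0 hA] := ge0_bound A; have [b b0 hB] := ge0_bound B.
have [d d0 hD] := ge0_bound D; have [e e0 hE] := ge0_bound E.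
exists (a + b + (d + e)) => u; apply: (le_trans (hsum_norm_le _)).
have bnd1 (T : bop H) m : 0 <= m -> (forall x, `|T x| <= m * `|x|) ->
    `|T u.1| <= m * `|u|.
  by move=> m0 h; apply: (le_trans (h _)); rewrite ler_wpM2l// hsum_norm_fst.
have bnd2 (T : bop H) m : 0 <= m -> (forall x, `|T x| <= m * `|x|) ->
    `|T u.2| <= m * `|u|.
  by move=> m0 h; apply: (le_trans (h _)); rewrite ler_wpM2l// hsum_norm_snd.
rewrite !mulrDl lerD//= (le_trans (ler_normD _ _))// lerD//.
- exact: bnd1.
- exact: bnd2.
- exact: bnd1.
- exact: bnd2.
Qed.

(* The operator [[A, B], [D, E]] on the direct sum of two copies of H. *)
Definition block : bop (hsum H) := Bop bounded_op_block.

End BlockOperators.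

Definition oplus (R : realType) (H : hilbertType R) (A B : bop H) :
  bop (hsum H) := block A 0 0 B.

(* Symmetric gauge functions on all real sequences: the value +oo is allowed,
   and a classical symmetric gauge function on finitely supported sequences is
   extended by its supremum over finite truncations. *)
Record symmetric_gauge (R : realType) (Phi : (nat -> R) -> \bar R) : Prop := {
  gauge_ge0 : forall x, (0 <= Phi x)%E ;
  gauge_eq0 : forall x, Phi x = 0%E -> x = (fun=> 0) ;
  gaugeZ : forall a x, Phi (fun n => a * x n) = (`|a|%:E * Phi x)%E ;
  gaugeD : forall x y, (Phi (fun n => (x n + y n)%R) <= Phi x + Phi y)%E ;
  gauge_abs : forall x, Phi (fun n => `|x n|) = Phi x ;
  gauge_perm : forall x (s : nat -> nat), bijective s -> Phi (x \o s) = Phi x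
}.

Definition gauge_norm (R : realType) (Phi : (nat -> R) -> \bar R)
    (K : hilbertType R) (X : bop K) : R :=
  fine (Phi (singular_value X)).

(* J is a two-sided ideal of B(K) on which N is a complete unitarily invariant
   norm; J is stable under scalars since a *: X = (a *: 1) * X. *)
Record ui_norm_ideal (R : realType) (K : hilbertType R) (J : set (bop K))
    (N : bop K -> R) : Prop := {
  ideal0 : J 0 ;
  idealD : forall X Y, J X -> J Y -> J (X + Y) ;
  idealM : forall A X B, J X -> J (A * X * B) ;
  norm_ge0 : forall X, J X -> 0 <= N X ;
  norm_eq0 : forall X, J X -> N X = 0 -> X = 0 ;
  normZ : forall a X, J X -> N (a *: X) = complex.Re `|a| * N X ;
  normD : forall X Y, J X -> J Y -> N (X + Y) <= N X + N Y ;
  norm_complete : forall X : nat -> bop K, (forall n, J (X n)) ->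
    (forall e, 0 < e -> exists n0, forall m n,
       (n0 <= m)%N -> (n0 <= n)%N -> N (X m - X n) < e) ->
    exists2 L, J L & N (X n - L) @[n --> \oo] --> (0 : R) ;
  norm_unitary : forall U V X, unitary U -> unitary V -> J X ->
    N (U * X * V) = N X
}.

Definition block_ideal (R : realType) (H : hilbertType R) (J : set (bop H)) :
    set (bop (hsum H)) :=
  [set Z | exists A B D E, [/\ J A, J B, J D & J E] /\ Z = block A B D E].

(* A unitarily invariant norm on an ideal of B(H), given by a symmetric gauge
   function of the singular values.  The same gauge function is required to
   define the corresponding unitarily invariant norm on the sum of two copies
   of H, the ideal there consisting of the operators with all four entries in
   the given ideal. *)
Record uinorm (R : realType) (H : hilbertType R) := UINorm {
  ui_gauge : (nat -> R) -> \bar R ;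
  ui_ideal : set (bop H) ;
  ui_gaugeP : symmetric_gauge ui_gauge ;
  ui_fin : forall X, ui_ideal X ->
    ui_gauge (singular_value X) \is a fin_num ;
  ui_fin_sum : forall Z, block_ideal ui_ideal Z ->
    ui_gauge (singular_value Z) \is a fin_num ;
  uiP : ui_norm_ideal ui_ideal (@gauge_norm R ui_gauge H) ;
  uiP_sum : ui_norm_ideal (block_ideal ui_ideal)
    (@gauge_norm R ui_gauge (hsum H))
}.

(* X may be an operator on H or on the sum of two copies of H. *)
Notation "'|||' X '|||_' N" := (gauge_norm (ui_gauge N) X)
  (at level 0, X at level 99, N at level 0, format "'|||' X '|||_' N")
  : ring_scope.

Section Inequalities.
Variables (R : realType) (H : hilbertType R).
Local Notation "S ^**" := (adjoint S) (at level 2, format "S ^**").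
Local Notation "S ^~1" := (inverse S) (at level 2, format "S ^~1").

Definition corach_porta_recht := forall (N : uinorm H) (S X : bop H),
  invertible S -> selfadjoint S -> ui_ideal N X ->
  ||| S * X * S^~1 + S^~1 * X * S |||_N >= 2 * ||| X |||_N.

Definition inequality_i := forall (N : uinorm H) (S X Y : bop H),
  invertible S -> ui_ideal N X -> ui_ideal N Y ->
  ||| oplus (S * Y * S^~1 + S^**^~1 * Y * S^**)
            (S^** * X * S^**^~1 + S^~1 * X * S) |||_N
  >= 2 * ||| oplus X Y |||_N.

Definition inequality_ii := forall (N : uinorm H) (S X Y : bop H),
  invertible S -> ui_ideal N X -> ui_ideal N Y ->
  ||| oplus (S * Y * S^**^~1 + S^**^~1 * Y * S)
            (S^** * X * S^~1 + S^~1 * X * S^**) |||_N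
  >= 2 * ||| oplus X Y |||_N.

End Inequalities.

(* Main.v *)
Require Import Defs.
From HB Require Import structures.
From mathcomp Require Import all_boot all_order all_algebra.
From mathcomp Require Import all_classical all_reals all_analysis.
From mathcomp Require Import complex.
From mathcomp Require Import ring lra.

(* For S invertible put D_S X = S X S^-1 + S^-1 X S.  The inequality
   |||D_S X||| >= 2 |||X||| is first proved for self-adjoint S in an arbitrary
   unitarily invariant norm ideal.  Since D_S X = U (D_T X) U with T = |S| and
   U unitary, one may take S = 1 - E with |E| < 1.  For E small, write
   (S + S^-1)/2 = 1 + p, (S - S^-1)/2 = A, sqrt (1 - A^2) = 1 - q and
   U = 1 - q + iA, which is unitary; then
     D_S X + (U X U^* + U^* X U)
       = 4 X + 2 ((p - q) X + X (p - q) + p X p + q X q),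
   where p, q = O(|E|^2) and p - q = O(|E|^4), so
   |||D_S X||| >= (2 - O(|E|^4)) |||X|||.  As D_(S^2) = D_S^2 - 2, a defect d
   for S gives a defect at most 4 d for S^2, whereas |E| is roughly halved by
   passing to the square root; iterating square roots, the defect vanishes.

   (i) and (ii) are this inequality on H + H for the self-adjoint operator
   [[0, S], [S^*, 0]] and the operators [[X, 0], [0, Y]] and [[0, X], [Y, 0]].
   All the assertions being true, they are equivalent. *)

Set Implicit Arguments.
Unset Strict Implicit.
Unset Printing Implicit Defensive.

Import Order.TTheory GRing.Theory Num.Theory.
Import numFieldNormedType.Exports.

Local Open Scope classical_set_scope.
Local Open Scope ring_scope.
Local Open Scope complex_scope.

(** Passage to the limit in a geometric error bound; most limiting arguments below end here. *)
Lemma geometric_le0 (R : realType) (a M r : R) : 0 <= r -> r < 1 ->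
  (forall n, a <= M * r ^+ n) -> a <= 0.
Proof.
move=> r0 r1 h; have c : M * r ^+ n @[n --> \oo] --> (0 : R).
  by apply: cvg_geometric; rewrite ger0_norm.
rewrite -(cvg_lim _ c)//; apply: limr_ge; first exact: cvgP c.
exact: nearW.
Qed.

Lemma le_of_sqr (R : realType) (a b : R) : 0 <= b -> a ^+ 2 <= b ^+ 2 -> a <= b.
Proof. by move=> b0 h; rewrite leNgt; apply/negP => ba; nra. Qed.

(** * The real inner product and completeness of the Hilbert space *)

Section RealNorm.
Variables (R : realType) (H : hilbertType R).
Local Notation C := R[i].
Implicit Types (x y z : H) (t : R).

(** The norm and the inner product take values in [R[i]]; their real parts lie in the ordered field
    [R], where [lra] and [nra] apply. *)
Definition rnorm x : R := complex.Re `|x|.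
Definition rdot x y : R := complex.Re (hdot x y).

Lemma rnormE x : `|x| = (rnorm x)%:C.
Proof. by rewrite /rnorm RRe_real// ger0_real. Qed.

Lemma rnorm_ge0 x : 0 <= rnorm x.
Proof. by rewrite -ler0c -rnormE. Qed.

Lemma rnormD x y : rnorm (x + y) <= rnorm x + rnorm y.
Proof. by rewrite -lecR rmorphD/= -!rnormE; exact: ler_normD. Qed.

Lemma rnormN x : rnorm (- x) = rnorm x.
Proof. by rewrite /rnorm normrN. Qed.

Lemma rnorm_distC x y : rnorm (x - y) = rnorm (y - x).
Proof. by rewrite -rnormN opprB. Qed.

Lemma rnormZ t x : 0 <= t -> rnorm (t%:C *: x) = t * rnorm x.
Proof.
by move=> t0; rewrite /rnorm normrZ ger0_norm ?ler0c// rnormE -rmorphM.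
Qed.

Lemma rnorm_le0 x : rnorm x <= 0 -> x = 0.
Proof. by rewrite -(lecR (rnorm x) 0) -rnormE normr_le0 => /eqP. Qed.

Lemma rdotxx x : rdot x x = rnorm x ^+ 2.
Proof. by rewrite /rdot -hdot_norm rnormE -rmorphXn. Qed.

Lemma rdotC x y : rdot x y = rdot y x.
Proof.
rewrite /rdot hermC/= expr0 mul1r; case: (hdot y x) => a b.
by [].
Qed.

Lemma rdotDl x y z : rdot (x + y) z = rdot x z + rdot y z.
Proof. by rewrite /rdot linearDl raddfD. Qed.

Lemma rdotDr x y z : rdot z (x + y) = rdot z x + rdot z y.
Proof. by rewrite rdotC rdotDl !(rdotC z). Qed.

Lemma rdotNl x y : rdot (- x) y = - rdot x y.
Proof. by rewrite /rdot linearNl raddfN. Qed.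

Lemma rdotNr x y : rdot x (- y) = - rdot x y.
Proof. by rewrite rdotC rdotNl rdotC. Qed.

Lemma rdotZl t x y : rdot (t%:C *: x) y = t * rdot x y.
Proof.
rewrite /rdot linearZl_LR/=; case: (hdot x y) => a b /=.
by rewrite mul0r subr0.
Qed.

Lemma rdotZr t x y : rdot x (t%:C *: y) = t * rdot x y.
Proof. by rewrite rdotC rdotZl rdotC. Qed.

Lemma rdot_scale (a : C) x y : rdot (a *: x) y = rdot x (a^*%C *: y).
Proof.
rewrite /rdot linearZl_LR linearZr_LR/=; congr (complex.Re (_ * _)).
by case: a => a b; rewrite -[RHS]/(a +i* (- - b)) opprK.
Qed.

(** Conjugate linearity in the second argument turns the imaginary part at [y] into the real part at
    ['i *: y], so [rdot] determines [hdot]. *)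
Lemma hdotE x y : hdot x y = rdot x y +i* rdot x ('i%C *: y).
Proof.
rewrite /rdot linearZr_LR/=; case: (hdot x y) => a b.
by congr (_ +i* _) => /=; ring.
Qed.

Lemma rnorm_sqD x y :
  rnorm (x + y) ^+ 2 = rnorm x ^+ 2 + 2 * rdot x y + rnorm y ^+ 2.
Proof. by rewrite -!rdotxx rdotDl !rdotDr (rdotC y x); ring. Qed.

(** Cauchy-Schwarz: expand the square of the norm of |y| x - |x| y and divide by 2 |x| |y|. *)
Lemma rdot_le x y : rdot x y <= rnorm x * rnorm y.
Proof.
have [y0|y0] := eqVneq (rnorm y) 0.
  have /rnorm_le0 -> : rnorm y <= 0 by rewrite y0.
  by rewrite /rdot linear0r mulr_ge0 ?rnorm_ge0.
have yp : 0 < rnorm y by rewrite lt_neqAle eq_sym y0 rnorm_ge0.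
have h (a b : R) : 0 <= a -> 0 <= b ->
    0 <= a ^+ 2 * rnorm x ^+ 2 - 2 * a * b * rdot x y + b ^+ 2 * rnorm y ^+ 2.
  move=> a0 b0; have := sqr_ge0 (rnorm (a%:C *: x - b%:C *: y)).
  rewrite rnorm_sqD rnormN !rnormZ// rdotNr rdotZl rdotZr => h.
  by apply: le_trans h _; rewrite le_eqVlt; apply/orP; left; apply/eqP; ring.
have [x0|x0] := eqVneq (rnorm x) 0.
  have /rnorm_le0 -> : rnorm x <= 0 by rewrite x0.
  by rewrite /rdot linear0l mulr_ge0 ?rnorm_ge0.
have xp : 0 < rnorm x by rewrite lt_neqAle eq_sym x0 rnorm_ge0.
have := h _ _ (ltW yp) (ltW xp).
have -> : rnorm y ^+ 2 * rnorm x ^+ 2 - 2 * rnorm y * rnorm x * rdot x y +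
  rnorm x ^+ 2 * rnorm y ^+ 2 =
  2 * (rnorm y * rnorm x) * (rnorm x * rnorm y - rdot x y) by ring.
by rewrite pmulr_rge0 ?mulr_gt0// subr_ge0.
Qed.

Lemma rdot_nondegenerate y z : (forall x, rdot x y = rdot x z) -> y = z.
Proof.
move=> h; apply/eqP; rewrite -subr_eq0; apply/eqP/rnorm_le0.
have : rnorm (y - z) ^+ 2 = 0.
  by rewrite -rdotxx rdotDr rdotNr h subrr.
by move/eqP; rewrite sqrf_eq0 => /eqP ->.
Qed.

(** Completeness with a rate: the bound is uniform in [k], so it survives when [k] tends to
    infinity. *)
Lemma geometric_cauchy (u : nat -> H) (M r : R) : 0 <= r -> r < 1 ->
  (forall n k, rnorm (u (n + k)%N - u n) <= M * r ^+ n) ->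
  exists l, forall n, rnorm (u n - l) <= M * r ^+ n.
Proof.
move=> r0 r1 h.
have M0 : 0 <= M.
  have := h 0%N 0%N; rewrite subrr expr0 mulr1.
  by apply: le_trans; exact: rnorm_ge0.
have e0 (e : R) : 0 < e -> exists n, M * r ^+ n < e.
  move=> e0; apply: contrapT => /forallNP g.
  have : e <= 0.
    apply: (@geometric_le0 _ _ M r) => // n.
    by rewrite leNgt; apply/negP; exact: g.
  by rewrite leNgt e0.
(* A positive element of [R[i]] is real, so real radii suffice. *)
have C0 (e : C) : 0 < e -> exists2 e' : R, 0 < e' & e = e'%:C.
  move=> ep; have er : (complex.Re e)%:C = e by rewrite RRe_real// gtr0_real.
  by exists (complex.Re e) => //; rewrite -(ltcR 0) er.
have uc : cauchy (u @ \oo).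
  apply/cauchyP => e /C0[e' e'0 ->]; have [n ne] := e0 _ e'0.
  exists (u n); exists n => // m /= nm.
  rewrite -ball_normE /= rnormE ltcR rnorm_distC.
  by apply: le_lt_trans ne; rewrite -(subnKC nm).
have /cvg_ex[l ul] : cvg (u @ \oo) by exact: cauchy_cvg.
exists l => n; apply/ler_addgt0Pr => e ep.
have ep' : 0 < e%:C by rewrite ltcR.
move/cvgrPdist_lt : ul => /(_ _ ep') [m _ hm].
have := hm (n + m)%N (leq_addl _ _); rewrite rnormE ltcR => lm.
rewrite rnorm_distC -[l](subrK (u (n + m)%N)) -addrA addrC.
by apply: (le_trans (rnormD _ _)); apply: lerD (h _ _) (ltW lm).
Qed.

End RealNorm.

(** * Bounded operators: norm estimates and completeness *)

Section Operators.
Variables (R : realType) (H : hilbertType R).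
Local Notation C := R[i].
Implicit Types (x y z : H) (S T W : bop H) (m t : R) (a : C).

Lemma bop_addE S T x : (S + T) x = S x + T x. Proof. by []. Qed.
Lemma bop_oppE S x : (- S) x = - S x. Proof. by []. Qed.
Lemma bop_mulE S T x : (S * T) x = S (T x). Proof. by []. Qed.
Lemma bop_scaleE a S x : (a *: S) x = a *: S x. Proof. by []. Qed.
Lemma bop_oneE x : (1 : bop H) x = x. Proof. by []. Qed.

Lemma bopD S x y : S (x + y) = S x + S y. Proof. exact: linearD. Qed.
Lemma bopN S x : S (- x) = - S x. Proof. exact: linearN. Qed.
Lemma bopZ S a x : S (a *: x) = a *: S x. Proof. exact: linearZ. Qed.

Lemma bop_scalerAl a S T : a *: (S * T) = (a *: S) * T.
Proof. exact: bop_ext. Qed.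

Lemma bop_scalerAr a S T : a *: (S * T) = S * (a *: T).
Proof. by apply: bop_ext => x; rewrite bop_mulE !bop_scaleE linearZ. Qed.

(** Stands for |S| <= m without the supremum in [opnorm]. *)
Definition op_le m S := forall x, rnorm (S x) <= m * rnorm x.

Lemma op_leW S : exists2 m, 0 < m & op_le m S.
Proof.
case: (bopP S) => M hM.
have hR x : rnorm (S x) <= complex.Re M * rnorm x.
  have ReM t (z : C) : complex.Re (z * t%:C) = complex.Re z * t.
    by case: z => a b /=; rewrite mulr0 subr0.
  by have := hM x; rewrite !rnormE lecE ReM => /andP[].
(* If H = 0 the given bound may be negative; otherwise a nonzero vector shows that it is
   nonnegative. *)
have [x [hx|hx]] : exists x, 0 < rnorm x \/ forall y, rnorm y <= 0.
- have [[x hx]|h] := pselect (exists x, 0 < rnorm x); first by exists x; left.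
  by exists 0; right => y; rewrite leNgt; apply/negP => hy; apply: h; exists y.
- exists (complex.Re M + 1).
    have := le_trans (rnorm_ge0 _) (hR x).
    by rewrite pmulr_lge0// => a0; rewrite ltr_wpDl.
  move=> y; apply: (le_trans (hR y)).
  by rewrite ler_wpM2r ?rnorm_ge0// lerDl.
- by exists 1 => // y; rewrite (rnorm_le0 (hx y)) linear0 mul1r.
Qed.

Lemma op_le_trans m m' S : m <= m' -> op_le m S -> op_le m' S.
Proof.
by move=> mm h x; apply: (le_trans (h x)); rewrite ler_wpM2r ?rnorm_ge0.
Qed.

Lemma op_leD m m' S T : op_le m S -> op_le m' T -> op_le (m + m') (S + T).
Proof.
move=> h h' x; rewrite mulrDl; apply: (le_trans (rnormD _ _)).
exact: lerD.
Qed.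

Lemma op_leN m S : op_le m S -> op_le m (- S).
Proof. by move=> h x; rewrite bop_oppE rnormN. Qed.

Lemma op_leB m m' S T : op_le m S -> op_le m' T -> op_le (m + m') (S - T).
Proof. by move=> h h'; apply: op_leD => //; exact: op_leN. Qed.

Lemma op_leM m m' S T : 0 <= m ->
  op_le m S -> op_le m' T -> op_le (m * m') (S * T).
Proof.
move=> m0 h h' x; apply: (le_trans (h _)).
by rewrite -mulrA ler_wpM2l.
Qed.

Lemma op_leZ m t S : 0 <= t -> op_le m S -> op_le (t * m) (t%:C *: S).
Proof. by move=> t0 h x; rewrite rnormZ// -mulrA ler_wpM2l. Qed.

Lemma bop_exists (f : H -> H) m : linear f ->
  (forall x, rnorm (f x) <= m * rnorm x) -> exists T : bop H, T =1 f.
Proof.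
move=> lf bf; pose F : {linear H -> H} :=
  HB.pack f (GRing.isLinear.Build _ _ _ _ f lf).
have bF : bounded_op F.
  by exists m%:C => x; rewrite !rnormE -rmorphM lecR; exact: bf.
by exists (Bop bF).
Qed.

(** The limit is taken pointwise. It is linear because a limit with a geometric rate is unique, and
    bounded because it stays within [m] of [u 0]. *)
Lemma bop_geometric_cauchy (u : nat -> bop H) m r : 0 <= r -> r < 1 ->
  (forall n k, op_le (m * r ^+ n) (u (n + k)%N - u n)) ->
  exists L, forall n, op_le (m * r ^+ n) (u n - L).
Proof.
move=> r0 r1 h.
have /choice[f hf] x : exists l, forall n,
    rnorm (u n x - l) <= m * rnorm x * r ^+ n.
  apply: geometric_cauchy => // n k; apply: le_trans (h n k x) _.
  by rewrite mulrAC.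
have f_unique x l c : (forall n, rnorm (u n x - l) <= c * r ^+ n) -> l = f x.
  move=> hl; apply/eqP; rewrite -subr_eq0; apply/eqP/rnorm_le0.
  apply: (@geometric_le0 _ _ (c + m * rnorm x) r) => // n.
  have -> : l - f x = (u n x - f x) - (u n x - l).
    by rewrite opprB [RHS]addrC addrA subrK.
  apply: (le_trans (rnormD _ _)); rewrite rnormN mulrDl addrC.
  exact: lerD.
have lf : linear f.
  move=> a x y; apply/esym.
  apply: (@f_unique _ _ (complex.Re `|a| * (m * rnorm x) + m * rnorm y)) => n.
  rewrite linearP opprD addrACA -scalerBr mulrDl.
  apply: (le_trans (rnormD _ _)); apply: lerD; last exact: hf.
  have -> : rnorm (a *: (u n x - f x)) =
      complex.Re `|a| * rnorm (u n x - f x).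
    rewrite /rnorm normrZ (rnormE (_ - _)) -[`|a|]RRe_real ?ger0_real//.
    by rewrite -rmorphM.
  rewrite -[leRHS]mulrA ler_wpM2l//.
  by rewrite -ler0c RRe_real// ger0_real.
have [r' r'0 hr] := op_leW (u 0%N).
have [|L hL] := @bop_exists f (m + r') lf.
  move=> x; rewrite -[f x](subrK (u 0%N x)) mulrDl.
  apply: (le_trans (rnormD _ _)); apply: lerD (hr x).
  by rewrite rnorm_distC; have := hf x 0%N; rewrite expr0 mulr1.
exists L => n x; rewrite bop_addE bop_oppE hL mulrAC.
exact: hf.
Qed.

Lemma op_le_geometric0 m r S : 0 <= r -> r < 1 ->
  (forall n, op_le (m * r ^+ n) S) -> S = 0.
Proof.
move=> r0 r1 h; apply: bop_ext => x; apply: rnorm_le0.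
apply: (@geometric_le0 _ _ (m * rnorm x) r) => // n; rewrite mulrAC.
exact: h.
Qed.

End Operators.

(** * Riesz representation and adjoints *)

Section Adjoints.
Variables (R : realType) (H : hilbertType R).
Local Notation C := R[i].
Implicit Types (x y z : H) (S T W : bop H) (m t : R) (a : C).

(** Real parts suffice by [hdotE], since [T] commutes with multiplication by i. *)
Lemma is_adjointP S T :
  is_adjoint S T <-> forall x y, rdot (S x) y = rdot x (T y).
Proof.
split=> [h x y|h x y]; first by rewrite /rdot h.
by rewrite !hdotE -linearZ h h linearZ.
Qed.

Lemma is_adjoint_uniq S T T' : is_adjoint S T -> is_adjoint S T' -> T = T'.
Proof.
move=> /is_adjointP h /is_adjointP h'; apply: bop_ext => y.
by apply: rdot_nondegenerate => x; rewrite -h -h'.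
Qed.

Lemma adjointE S T : is_adjoint S T -> adjoint S = T.
Proof.
by move=> h; apply: xget_unique => // T' h'; exact: is_adjoint_uniq h' h.
Qed.

Lemma is_adjoint_sym S T : is_adjoint S T -> is_adjoint T S.
Proof.
move=> /is_adjointP h; apply/is_adjointP => x y.
by rewrite rdotC -h rdotC.
Qed.

Lemma is_adjoint1 : is_adjoint (1 : bop H) 1. Proof. by []. Qed.

Lemma is_adjoint0 : is_adjoint (0 : bop H) 0.
Proof. by apply/is_adjointP => x y; rewrite /rdot linear0l linear0r. Qed.

Lemma is_adjointD S S' T T' :
  is_adjoint S T -> is_adjoint S' T' -> is_adjoint (S + S') (T + T').
Proof.
move=> /is_adjointP h /is_adjointP h'; apply/is_adjointP => x y.
by rewrite !bop_addE rdotDl rdotDr h h'.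
Qed.

Lemma is_adjointN S T : is_adjoint S T -> is_adjoint (- S) (- T).
Proof.
move=> /is_adjointP h; apply/is_adjointP => x y.
by rewrite !bop_oppE rdotNl rdotNr h.
Qed.

Lemma is_adjointM S S' T T' :
  is_adjoint S T -> is_adjoint S' T' -> is_adjoint (S * S') (T' * T).
Proof. by move=> h h' x y; rewrite !bop_mulE h h'. Qed.

Lemma is_adjointZ a S T : is_adjoint S T -> is_adjoint (a *: S) (a^*%C *: T).
Proof.
move=> /is_adjointP h; apply/is_adjointP => x y.
by rewrite !bop_scaleE rdot_scale h linearZ.
Qed.

Lemma is_adjoint_inverse S Si :
  S * Si = 1 -> Si * S = 1 -> is_adjoint S S -> is_adjoint Si Si.
Proof.
move=> r l h x y; rewrite -[in LHS](bop_oneE y) -r bop_mulE -h.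
by rewrite -bop_mulE r bop_oneE.
Qed.

Lemma selfadjoint_is_adjoint S : selfadjoint S -> is_adjoint S S.
Proof.
(* If [S] had no adjoint, [adjoint S] would be the default value 0; then S = 0, which is its own
   adjoint. *)
rewrite /selfadjoint /adjoint; case: xgetP => [T -> hT E|hS <-].
  by move: hT; rewrite E.
exact: is_adjoint0.
Qed.

Lemma unitary_intro S T : is_adjoint S T -> S * T = 1 -> T * S = 1 -> unitary S.
Proof. by move=> /adjointE aS h h'; split; rewrite aS. Qed.

Section Riesz.
Variables (f : H -> R) (m : R).
Hypotheses (fD : forall x y, f (x + y) = f x + f y)
  (fZ : forall t x, f (t%:C *: x) = t * f x)
  (f_le : forall x, f x <= m * rnorm x).

Let g x := rnorm x ^+ 2 - 2 * f x.

Let g_parallelogram x y :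
  rnorm (x - y) ^+ 2 = 2 * g x + 2 * g y - 4 * g ((2^-1)%:C *: (x + y)).
Proof.
have fxy : f (2^-1%:C *: (x + y)) = 2^-1 * (f x + f y) by rewrite fZ fD.
rewrite /g fxy rnormZ ?invr_ge0// exprMn !rnorm_sqD rnormN rdotNr.
by field.
Qed.

(* The representing vector minimizes x |-> |x|^2 - 2 f x; by the parallelogram
   identity every minimizing sequence of this functional is Cauchy. *)
Lemma riesz : exists z, forall x, f x = rdot x z.
Proof.
pose G := [set g x | x in [set: H]].
have G0 : has_inf G.
  split; first by exists (g 0); exists 0.
  exists (- m ^+ 2) => _ [x _ <-]; rewrite /g.
  have := f_le x; have := sqr_ge0 (rnorm x - m); nra.
have infG x : inf G <= g x by apply: ge_inf; [exact: G0.2|exists x].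
(* With error 4^-n in the functional, the parallelogram identity bounds squared distances by 4 *
   4^-n, hence distances by 2 * 2^-n. *)
have /choice[u hu] n : exists x, g x <= inf G + 4^-1 ^+ n.
  have [|_ [x _ <-] hx] := @inf_adherent _ G (4^-1 ^+ n) _ G0.
    by rewrite exprn_gt0// invr_gt0.
  by exists x; exact: ltW.
have [||n k|z hz] := @geometric_cauchy _ _ u 2 2^-1; [lra|lra| |].
  apply: le_of_sqr; first by rewrite mulr_ge0// exprn_ge0// invr_ge0.
  rewrite g_parallelogram exprMn -exprM mulnC exprM.
  have -> : (2^-1 ^+ 2 : R) = 4^-1 by field.
  have := infG (2^-1%:C *: (u (n + k)%N + u n)).
  have := hu n; have := hu (n + k)%N; rewrite exprD.
  have : (4^-1 ^+ k : R) <= 1 by rewrite exprn_ile1//; lra.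
  have : 0 <= (4^-1 ^+ n : R) by rewrite exprn_ge0//; lra.
  nra.
exists z => x; rewrite rdotC.
(* Near-minimality of [u n] along the line [u n + t x] makes a quadratic in t nonnegative; its value
   at the minimizer t = - d / |x|^2 gives d^2 <= 4^-n |x|^2. *)
have du n : `|rdot (u n) x - f x| <= rnorm x * 2^-1 ^+ n.
  set d := rdot (u n) x - f x.
  have dt t : 0 <= 4^-1 ^+ n + 2 * t * d + t ^+ 2 * rnorm x ^+ 2.
    have := infG (u n + t%:C *: x); have := hu n.
    rewrite /g rnorm_sqD fD fZ rdotZr -[in rnorm (_ *: _) ^+ 2]rdotxx.
    rewrite rdotZl rdotZr rdotxx /d; nra.
  apply: le_of_sqr; first by rewrite mulr_ge0 ?rnorm_ge0// exprn_ge0 ?invr_ge0.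
  rewrite real_normK ?num_real// exprMn -exprM mulnC exprM.
  have -> : (2^-1 ^+ 2 : R) = 4^-1 by field.
  have [x0|x0] := eqVneq (rnorm x) 0.
    have /rnorm_le0 xz : rnorm x <= 0 by rewrite x0.
    have f0 : f 0 = 0 by have := fD 0 0; rewrite addr0; lra.
    rewrite /d xz f0 /rdot linear0r raddf0 subrr expr0n /=.
    by apply: mulr_ge0; [exact: sqr_ge0|apply: exprn_ge0; lra].
  have xp0 : 0 < rnorm x by rewrite lt_neqAle eq_sym x0 rnorm_ge0.
  have xp : 0 < rnorm x ^+ 2 by exact: exprn_gt0.
  have := dt (- d / rnorm x ^+ 2).
  have -> : 4^-1 ^+ n + 2 * (- d / rnorm x ^+ 2) * d +
    (- d / rnorm x ^+ 2) ^+ 2 * rnorm x ^+ 2 = 4^-1 ^+ n - d ^+ 2 / rnorm x ^+ 2.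
    by field; exact: x0.
  by rewrite subr_ge0 ler_pdivrMr// mulrC.
apply/eqP; rewrite -subr_eq0 -normr_le0.
apply: (@geometric_le0 _ _ (3 * rnorm x) 2^-1); [lra|lra|] => n.
have -> : f x - rdot z x = rdot (u n - z) x - (rdot (u n) x - f x).
  by rewrite rdotDl rdotNl; ring.
apply: (le_trans (ler_normB _ _)).
have h : `|rdot (u n - z) x| <= 2 * 2^-1 ^+ n * rnorm x.
  rewrite ler_norml lerNl -rdotNl.
  apply/andP; split; apply: (le_trans (rdot_le _ _)).
    by rewrite rnormN ler_wpM2r ?rnorm_ge0.
  by rewrite ler_wpM2r ?rnorm_ge0.
apply: (le_trans (lerD h (du n))).
by rewrite le_eqVlt; apply/orP; left; apply/eqP; ring.
Qed.

End Riesz.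

Lemma adjoint_exists S : exists T, is_adjoint S T.
Proof.
have [m m0 hS] := op_leW S.
have /choice[f hf] y : exists z, forall x, rdot (S x) y = rdot x z.
  apply: (@riesz _ (m * rnorm y)) => [x x'|t x|x].
  - by rewrite linearD rdotDl.
  - by rewrite linearZ rdotZl.
  - apply: (le_trans (rdot_le _ _)); rewrite mulrAC.
    by rewrite ler_wpM2r ?rnorm_ge0.
have lf : linear f.
  move=> a y y'; apply: rdot_nondegenerate => x.
  have aS : rdot x (a *: f y) = rdot (S x) (a *: y).
    by rewrite -[a]conjcK -!rdot_scale -linearZ hf.
  by rewrite -hf !rdotDr aS -hf.
have [|T hT] := @bop_exists _ _ f m lf.
  (* Boundedness: |f y|^2 = Re <S (f y), y> <= m |f y| |y|, and |f y| cancels. *)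
  move=> y; have := rdot_le (S (f y)) y; rewrite hf rdotxx => h.
  have [->|fy0] := eqVneq (rnorm (f y)) 0.
    by rewrite mulr_ge0 ?rnorm_ge0// ltW.
  have fyp : 0 < rnorm (f y) by rewrite lt_neqAle eq_sym fy0 rnorm_ge0.
  rewrite -(ler_pM2l fyp) -expr2 (le_trans h)// mulrCA mulrA.
  by rewrite ler_wpM2r ?rnorm_ge0.
by exists T; apply/is_adjointP => x y; rewrite hf hT.
Qed.

Lemma adjointP S : is_adjoint S (adjoint S).
Proof. by have [T hT] := adjoint_exists S; rewrite (adjointE hT). Qed.

End Adjoints.

(* An identity between operators is checked on the real parts of the matrix
   entries, where it is a linear identity between real numbers. *)
Ltac bop_entries :=
  let x := fresh "x" in let z := fresh "z" in
  apply: bop_ext => x; apply: rdot_nondegenerate => z;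
  rewrite ?(bop_addE, bop_oppE, bop_mulE, bop_scaleE, bop_oneE, bopD, bopN,
            bopZ, rdotDr, rdotNr, rdotZr).
Ltac bop_ring := bop_entries; lra.

Lemma bop_mulK (R : realType) (H : hilbertType R) (S T : bop H) :
  S * T = 1 -> forall x, S (T x) = x.
Proof. by move=> ST x; rewrite -bop_mulE ST. Qed.

(** * Square roots of operators near the identity *)

Section SquareRoot.
Variables (R : realType) (H : hilbertType R).
Implicit Types (E S T W : bop H) (m t : R).
Local Notation half := ((2^-1 : R)%:C).

Lemma op_le_limit c m r S : 0 <= r -> r < 1 ->
  (forall n, op_le (c + m * r ^+ n) S) -> op_le c S.
Proof.
move=> r0 r1 h x; rewrite -subr_le0.
apply: (@geometric_le0 _ _ (m * rnorm x) r) => // n.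
have := h n x; rewrite mulrDl; lra.
Qed.

(** (1 - Y)^2 = 1 - E means that Y is a fixed point of Y |-> (E + Y^2) / 2. The ball of radius r = e
    / (2 - e) is mapped into itself because r <= e, and on commuting iterates in it the map
    contracts by r. Iterates from 0 are self-adjoint and commute with whatever commutes with E. The
    radius r is a rational upper bound for 1 - sqrt (1 - e). *)
Lemma sqrt_near1 E e : 0 <= e -> e < 1 -> op_le e E -> is_adjoint E E ->
  exists Y : bop H, [/\ is_adjoint Y Y, op_le (e / (2 - e)) Y,
    (1 - Y) * (1 - Y) = 1 - E & forall W, W * E = E * W -> W * Y = Y * W].
Proof.
move=> e0 e1 hE aE; set r := e / (2 - e).
have re : r * (2 - e) = e by rewrite /r divfK//; lra.
have r0 : 0 <= r by rewrite /r divr_ge0//; lra.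
have r1 : r < 1 by nra.
have rlee : r <= e by nra.
pose u n := iter n (fun Y => half *: (E + Y * Y)) 0.
have uS n : u n.+1 = half *: (E + u n * u n) by [].
have u_le n : op_le r (u n).
  elim: n => [|n IH].
    by move=> x; rewrite /rnorm normr0 mulr_ge0// rnorm_ge0.
  rewrite uS; apply: (@op_le_trans _ _ (2^-1 * (e + r * r))); first by nra.
  apply: op_leZ; first lra.
  by apply: op_leD => //; exact: op_leM.
have u_adj n : is_adjoint (u n) (u n).
  elim: n => [|n IH]; first exact: is_adjoint0.
  rewrite uS -[X in is_adjoint _ (X *: _)]conjc_real.
  apply: is_adjointZ; apply: is_adjointD => //.
  exact: is_adjointM.
have u_comm n W : W * E = E * W -> W * u n = u n * W.
  move=> WE; elim: n => [|n IH]; first by rewrite mul0r mulr0.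
  rewrite uS -bop_scalerAr -bop_scalerAl mulrDl mulrDr WE.
  by rewrite mulrA IH -mulrA IH mulrA.
have [n k|L hL] := @bop_geometric_cauchy _ _ u r r r0 r1.
  elim: n => [|n IH].
    by rewrite expr0 mulr1 subr0 add0n.
  rewrite addSn !uS.
  have -> : half *: (E + u (n + k)%N * u (n + k)%N) - half *: (E + u n * u n) =
    half *: (u (n + k)%N * (u (n + k)%N - u n) + (u (n + k)%N - u n) * u n).
    bop_ring.
  apply: (@op_le_trans _ _ (2^-1 * (r * (r * r ^+ n) + (r * r ^+ n) * r))).
    by rewrite le_eqVlt exprS; apply/orP; left; apply/eqP; field.
  apply: op_leZ; first lra.
  apply: op_leD; apply: op_leM => //.
  by rewrite mulr_ge0// exprn_ge0.
have rn0 n : 0 <= r * r ^+ n by rewrite mulr_ge0// exprn_ge0.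
have L_le : op_le r L.
  apply: (@op_le_limit _ r r) => // n.
  have -> : L = u n - (u n - L) by bop_ring.
  exact: op_leB.
exists L; split=> //.
- apply/is_adjointP.
  (* One inequality is enough: exchanging [x] and [y] gives the other. *)
  have h x y : rdot (L x) y - rdot x (L y) <= 0.
    apply: (@geometric_le0 _ _ (2 * r * rnorm x * rnorm y) r) => // n.
    have -> : rdot (L x) y - rdot x (L y) =
        rdot x ((u n - L) y) + rdot (- (u n - L) x) y.
      rewrite !(bop_addE, bop_oppE, rdotDl, rdotDr, rdotNl, rdotNr).
      by rewrite ((is_adjointP _ _).1 (u_adj n)); ring.
    have h1 := le_trans (rdot_le x ((u n - L) y))
      (ler_wpM2l (rnorm_ge0 x) (hL n y)).
    have h2 := le_trans (rdot_le (- (u n - L) x) y)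
      (ler_wpM2r (rnorm_ge0 y) (op_leN (hL n) x)).
    apply: (le_trans (lerD h1 h2)).
    by rewrite le_eqVlt; apply/orP; left; apply/eqP; ring.
  move=> x y; apply/eqP; rewrite eq_le -subr_le0 h -subr_le0.
  by have := h y x; rewrite (rdotC (L y)) (rdotC y).
- have E_L : half *: (E + L * L) - L = 0.
    apply: (@op_le_geometric0 _ _ (2 * r) r) => // n.
    have -> : half *: (E + L * L) - L =
      (u n.+1 - L) - half *: (u n * (u n - L) + (u n - L) * L).
      by rewrite uS; bop_ring.
    apply: (@op_le_trans _ _
      (r * r ^+ n.+1 + 2^-1 * (r * (r * r ^+ n) + (r * r ^+ n) * r))).
      rewrite exprS; have := rn0 n; nra.
    apply: op_leB => //; apply: op_leZ; first lra.
    by apply: op_leD; apply: op_leM.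
  have -> : E = (half *: (E + L * L) - L) + (half *: (E + L * L) - L)
    + (L + L - L * L) by bop_ring.
  rewrite E_L !add0r; bop_ring.
- move=> W WE; apply/eqP; rewrite -subr_eq0; apply/eqP.
  have [w w0 hW] := op_leW W.
  apply: (@op_le_geometric0 _ _ (2 * w * r) r) => // n.
  have -> : W * L - L * W = (u n - L) * W - W * (u n - L).
    rewrite mulrBl mulrBr (u_comm _ _ WE); bop_ring.
  apply: (@op_le_trans _ _ (r * r ^+ n * w + w * (r * r ^+ n))).
    by rewrite le_eqVlt; apply/orP; left; apply/eqP; ring.
  by apply: op_leB; apply: op_leM => //; exact: ltW.
Qed.

End SquareRoot.

(** * Unitarily invariant norm ideals *)

Section NormIdeal.
Variables (R : realType) (H : hilbertType R).
Variables (J : set (bop H)) (N : bop H -> R).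
Hypothesis JN : ui_norm_ideal J N.
Implicit Types (E S Si T U V X Y p q : bop H) (m t : R).
Local Notation half := ((2^-1 : R)%:C).

Lemma idealZ (a : R[i]) X : J X -> J (a *: X).
Proof.
move=> JX; have -> : a *: X = (a *: (1 : bop H)) * X * 1.
  by rewrite mulr1 -bop_scalerAl mul1r.
exact: (idealM JN).
Qed.

Lemma ideal_mull A X : J X -> J (A * X).
Proof. by move=> JX; rewrite -[A * X]mulr1; apply: (idealM JN). Qed.

Lemma ideal_mulr A X : J X -> J (X * A).
Proof. by move=> JX; rewrite -[X]mul1r; apply: (idealM JN). Qed.

Lemma ideal_realZ t X : 0 <= t -> J X -> N (t%:C *: X) = t * N X.
Proof. by move=> t0 JX; rewrite (normZ JN)// ger0_norm// ler0c. Qed.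

Lemma unitary1 : unitary (1 : bop H).
Proof.
by apply: (@unitary_intro _ H 1 1); rewrite ?mulr1//; exact: is_adjoint1.
Qed.

(** The operator form of cos + i sin: for commuting self-adjoint c and p, (c + i p) (c - i p) = c^2
    + p^2 = 1. *)
Lemma unitary_cayley c p : is_adjoint c c -> is_adjoint p p ->
  c * c = 1 - p * p -> c * p = p * c ->
  unitary (c + 'i%C *: p) /\ unitary (c - 'i%C *: p).
Proof.
move=> ac ap cc cp.
have ii : 'i%C * 'i%C = -1 :> R[i] by rewrite -expr2 sqr_i.
have aU : is_adjoint (c + 'i%C *: p) (c - 'i%C *: p).
  apply: is_adjointD => //.
  have -> : - ('i%C *: p) = ('i%C)^*%C *: p.
    by rewrite -scaleNr; congr (_ *: p); rewrite /= -[LHS]/(- 0 +i* - 1) oppr0.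
  exact: is_adjointZ.
have UV : (c + 'i%C *: p) * (c - 'i%C *: p) = 1.
  rewrite mulrDl !mulrBr cc -!bop_scalerAl -!bop_scalerAr cp scalerA ii.
  by rewrite scaleN1r opprK addrA subrK subrK.
have VU : (c - 'i%C *: p) * (c + 'i%C *: p) = 1.
  rewrite mulrBl !mulrDr cc -!bop_scalerAl -!bop_scalerAr cp scalerA ii.
  by rewrite scaleN1r opprD opprK addrA addrK subrK.
split; first exact: unitary_intro aU UV VU.
exact: unitary_intro (is_adjoint_sym aU) VU UV.
Qed.

(** Take 1 - q = sqrt (1 - p^2), which exists by [sqrt_near1] with e = m^2 < 1 and commutes with
    p. *)
Lemma unitary_of_contraction p m : is_adjoint p p -> op_le m p ->
  0 <= m -> m < 1 -> exists q, [/\ is_adjoint q q,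
    op_le (m ^+ 2 / (2 - m ^+ 2)) q, (1 - q) * (1 - q) = 1 - p * p,
    unitary ((1 - q) + 'i%C *: p) & unitary ((1 - q) - 'i%C *: p)].
Proof.
move=> ap hp m0 m1.
have [||||q [aq hq qq qc]] := @sqrt_near1 _ _ (p * p) (m ^+ 2).
- exact: sqr_ge0.
- by rewrite expr_lt1.
- by rewrite expr2; exact: op_leM.
- exact: is_adjointM.
have pq : p * q = q * p by apply: qc; rewrite mulrA.
have ac : is_adjoint (1 - q) (1 - q).
  by apply: is_adjointD => //; exact: is_adjointN.
have cp : (1 - q) * p = p * (1 - q) by rewrite mulrBl mulrBr mul1r mulr1 pq.
have [uU uV] := unitary_cayley ac ap qq cp.
by exists q.
Qed.

(* A self-adjoint contraction is the mean of two unitaries. *)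
Lemma norm_le_of_unitary (F : bop H -> bop H) (p : bop H) m c :
  {morph F : S T / S + T} -> (forall a, {morph F : S / a *: S}) ->
  (forall U, unitary U -> J (F U) /\ N (F U) <= c) ->
  is_adjoint p p -> op_le m p -> 0 <= m -> J (F p) /\ N (F p) <= m * c.
Proof.
move=> FD FZ FU ap hp m0.
have c0 : 0 <= c.
  by have [JF] := FU _ unitary1; apply: le_trans; exact: (norm_ge0 JN).
have contr p' m' : is_adjoint p' p' -> op_le m' p' -> 0 <= m' -> m' < 1 ->
    J (F p') /\ N (F p') <= c.
  move=> ap' hp' m'0 m'1.
  have [q [_ _ _ uU uV]] := unitary_of_contraction ap' hp' m'0 m'1.
  set U := _ + _ in uU; set V := _ - _ in uV.
  (* U - V = 2 i p', hence p' = - (i / 2) U + (i / 2) V. *)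
  have -> : p' = (- (half * 'i%C)) *: U + (half * 'i%C) *: V.
    rewrite /U /V scalerBr scalerDr !scalerA !scaleNr mulNr -mulrA -expr2 sqr_i.
    rewrite mulrN1 opprK scaleNr opprK addrACA addNr add0r -scalerDl -rmorphD.
    have -> : (2^-1 + 2^-1 : R) = 1 by field.
    by rewrite scale1r.
  have [JU NU] := FU _ uU; have [JV NV] := FU _ uV.
  rewrite FD !FZ; split; first by apply: (idealD JN); exact: idealZ.
  apply: (le_trans (normD JN (idealZ _ JU) (idealZ _ JV))).
  rewrite !(normZ JN)// normrN.
  have -> : complex.Re `|half * 'i%C| = 2^-1 :> R.
    rewrite normrM ger0_norm ?ler0c ?invr_ge0//.
    have -> : `|'i%C| = 1 :> R[i] by rewrite complexiE normCi.
    by rewrite mulr1.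
  lra.
(* The square root needs a strict contraction: apply [contr] to p / r, then let r decrease to m. *)
have scaled r : m < r -> J (F p) /\ N (F p) <= r * c.
  move=> mr; have r0 : 0 < r by apply: le_lt_trans mr.
  have ri : 0 <= r^-1 by rewrite invr_ge0 ltW.
  have [||||JF NF] := contr (r^-1%:C *: p) (r^-1 * m).
  - by rewrite -[X in is_adjoint _ (X *: _)]conjc_real; exact: is_adjointZ.
  - exact: op_leZ.
  - exact: mulr_ge0.
  - by rewrite mulrC ltr_pdivrMr// mul1r.
  have pE : p = r%:C *: (r^-1%:C *: p).
    by rewrite scalerA -rmorphM divff ?scale1r// gt_eqF.
  rewrite pE FZ; split; first exact: idealZ.
  by rewrite ideal_realZ ?ler_wpM2l// ltW.
split; first by have [|//] := scaled (m + 1); rewrite ltrDl.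
apply/ler_addgt0Pr => e e0.
(* The excess e / (c + 1) costs at most e after multiplication by c; the 1 covers c = 0. *)
have [|_ /le_trans] := scaled (m + e / (c + 1)).
  by rewrite ltrDl divr_gt0// ltr_wpDl.
apply; rewrite mulrDl lerD2l mulrAC ler_pdivrMr ?ltr_wpDl//.
by rewrite ler_pM2l// lerDl.
Qed.

Lemma norm_mul_unitaryl U X : unitary U -> J X -> N (U * X) = N X.
Proof.
move=> uU JX; rewrite -[U * X]mulr1; exact: (norm_unitary JN _ unitary1).
Qed.

Lemma norm_mul_unitaryr U X : unitary U -> J X -> N (X * U) = N X.
Proof.
move=> uU JX; rewrite -[X]mul1r; rewrite (norm_unitary JN unitary1)//.
by rewrite mul1r.
Qed.

Lemma norm_selfadjoint_mull p m X :
  is_adjoint p p -> op_le m p -> 0 <= m -> J X ->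
  N (p * X) <= m * N X.
Proof.
move=> ap hp m0 JX.
apply: (proj2 (@norm_le_of_unitary (fun S => S * X) p m (N X) _ _ _ ap hp m0)).
- by move=> S T; rewrite mulrDl.
- by move=> a S; rewrite bop_scalerAl.
- by move=> U uU; split; [exact: ideal_mull|rewrite norm_mul_unitaryl].
Qed.

Lemma norm_selfadjoint_mulr p m X :
  is_adjoint p p -> op_le m p -> 0 <= m -> J X ->
  N (X * p) <= m * N X.
Proof.
move=> ap hp m0 JX.
apply: (proj2 (@norm_le_of_unitary (fun S => X * S) p m (N X) _ _ _ ap hp m0)).
- by move=> S T; rewrite mulrDr.
- by move=> a S; rewrite bop_scalerAr.
- by move=> U uU; split; [exact: ideal_mulr|rewrite norm_mul_unitaryr].
Qed.

(** * The inequality for self-adjoint operators near the identity *)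

(** The inequality with defect [d], the goal being d = 0; [Si] stands for the inverse of [S]. *)
Definition cpr_expanding d S Si := forall X, J X ->
  (2 - d) * N X <= N (S * X * Si + Si * X * S).

Lemma ideal_cpr S Si X : J X -> J (S * X * Si + Si * X * S).
Proof. by move=> JX; apply: (idealD JN); exact: (idealM JN). Qed.

(* With D_S X = S X S^-1 + S^-1 X S one has D_(S^2) = D_S^2 - 2. *)
Lemma cpr_expanding_sqr d S Si : S * Si = 1 -> Si * S = 1 -> 0 <= d ->
  cpr_expanding d S Si -> cpr_expanding (4 * d) (S * S) (Si * Si).
Proof.
move=> r l d0 h X JX; set Z := S * S * X * (Si * Si) + Si * Si * X * (S * S).
have NX0 := norm_ge0 JN JX.
have JY := ideal_cpr S Si JX; set Y := S * X * Si + Si * X * S in JY.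
have hX := h X JX; have hY := h Y JY; have JW := ideal_cpr S Si JY.
have E : S * Y * Si + Si * Y * S = Z + 2%:C *: X.
  by rewrite /Y /Z; bop_entries; rewrite !(bop_mulK r, bop_mulK l); lra.
have JZ : J Z by exact: ideal_cpr.
rewrite E in hY.
have := normD JN JZ (idealZ 2%:C JX).
rewrite ideal_realZ// => hZ.
(* For d <= 2 the hypothesis is used twice and (2 - d)^2 - 2 >= 2 - 4 d; for d > 2 the left side of
   the claim is not positive. *)
have [d2|d2] := leP d 2; last by have := norm_ge0 JN JZ; nra.
have : (2 - d) * ((2 - d) * N X) <= (2 - d) * N Y by rewrite ler_wpM2l// subr_ge0.
nra.
Qed.

(** 1 - E is bounded below: |(1 - E) y| >= (1 - e) |y|. *)
Lemma op_le_inverse E e Si : 0 <= e -> e < 1 -> op_le e E ->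
  (1 - E) * Si = 1 -> op_le (1 - e)^-1 Si.
Proof.
move=> e0 e1 hE r x; have e1' : 0 < 1 - e by lra.
rewrite mulrC ler_pdivlMr//.
have {2}<- := bop_mulK r x; set y := Si x.
have := rnormD ((1 - E) y) (E y); rewrite bop_addE bop_oppE bop_oneE subrK.
have := hE y; lra.
Qed.

Lemma cpr_expanding_base E Si e : 0 <= e -> e <= 4^-1 -> op_le e E ->
  is_adjoint E E -> (1 - E) * Si = 1 -> Si * (1 - E) = 1 ->
  cpr_expanding (24 * e ^+ 4) (1 - E) Si.
Proof.
move=> e0 e4 hE aE r l X JX.
have aS : is_adjoint (1 - E) (1 - E).
  by apply: is_adjointD; [exact: is_adjoint1|exact: is_adjointN].
have aSi := is_adjoint_inverse r l aS.
have hSi : op_le (4 / 3) Si.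
  apply: (@op_le_trans _ _ (1 - e)^-1); last by apply: op_le_inverse r => //; lra.
  rewrite -[leRHS]invf_div lef_pV2 ?posrE; lra.
have halfC : half = half^*%C by rewrite conjc_real.
pose A := half *: (1 - E - Si); pose p := half *: (1 - E + Si) - 1.
have aA : is_adjoint A A.
  rewrite /A {2}halfC; apply: is_adjointZ; apply: is_adjointD => //.
  exact: is_adjointN.
have ap : is_adjoint p p.
  rewrite /p {2}halfC; apply: is_adjointD; last exact/is_adjointN/is_adjoint1.
  by apply: is_adjointZ; apply: is_adjointD.
(* S - S^-1 = S^-1 (S^2 - 1) is of first order in E, while S + S^-1 - 2 = S^-1 (S - 1)^2 is of
   second order. *)
have EA : A = half *: (Si * (E * E - (E + E))).
  have -> : E * E - (E + E) = (1 - E) * (1 - E) - 1 by bop_ring.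
  by rewrite mulrBr mulrA l mul1r mulr1.
have Ep : p = half *: (Si * (E * E)).
  have -> : E * E = (1 - E) * (1 - E) + 1 - (1 - E) - (1 - E) by bop_ring.
  rewrite /p; move: (1 - E) l => S l; bop_entries.
  by rewrite !(bop_mulK l); lra.
have hA : op_le (3 / 2 * e) A.
  rewrite EA; apply: (@op_le_trans _ _ (2^-1 * (4 / 3 * (e * e + (e + e))))).
    nra.
  apply: op_leZ; first lra.
  apply: op_leM => //.
  apply: op_leB; last exact: op_leD.
  exact: op_leM.
have hp : op_le (2 / 3 * e ^+ 2) p.
  rewrite Ep; apply: (@op_le_trans _ _ (2^-1 * (4 / 3 * (e * e)))).
    by rewrite expr2; lra.
  apply: op_leZ; first lra.
  apply: op_leM => //.
  exact: op_leM.
have [||q [aq hq qq uU uV]] := unitary_of_contraction aA hA; [lra|lra|].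
have hq' : op_le (9 / 4 * e ^+ 2) q.
  apply: op_le_trans hq; have e2 := sqr_ge0 e.
  have e2' : e ^+ 2 <= 16^-1 by nra.
  have -> : (3 / 2 * e) ^+ 2 = 9 / 4 * e ^+ 2 by field.
  by rewrite ler_pdivrMr; nra.
(* (1 + p)^2 - A^2 = 1, the analogue of cosh^2 - sinh^2 = 1. *)
have pp : p * p + p + p = A * A.
  rewrite /p /A; move: (1 - E) r l => S r l; bop_entries.
  by rewrite !(bop_mulK r, bop_mulK l); lra.
pose d := p - q.
(* 2 p = A^2 - p^2 and 2 q = A^2 + q^2: the second-order terms cancel in p - q, leaving order
   e^4. *)
have Ed : d = - (half *: (p * p + q * q)).
  have -> : p * p + q * q =
    (A * A - p - p) + ((1 - q) * (1 - q) - 1 + q + q).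
    by rewrite -pp; move: (p) (q) => p' q'; bop_ring.
  by rewrite qq /d; move: (A) (p) (q) => A' p' q'; bop_ring.
have ad : is_adjoint d d by apply: is_adjointD => //; exact: is_adjointN.
have hd : op_le (3 * e ^+ 4) d.
  rewrite Ed; apply: op_leN.
  apply: (@op_le_trans _ _ (2^-1 * (2 / 3 * e ^+ 2 * (2 / 3 * e ^+ 2) +
    9 / 4 * e ^+ 2 * (9 / 4 * e ^+ 2)))).
    have -> : e ^+ 4 = e ^+ 2 * e ^+ 2 by rewrite -exprD.
    by have := sqr_ge0 (e ^+ 2); rewrite !expr2; lra.
  apply: op_leZ; first lra.
  have e2 := sqr_ge0 e.
  by apply: op_leD; apply: op_leM => //; lra.
have NX0 := norm_ge0 JN JX.
have e2 := sqr_ge0 e; have e40 : 0 <= e ^+ 4 by exact: exprn_ge0.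
pose c := 1 - q; pose U := c + 'i%C *: A; pose V := c - 'i%C *: A.
pose W := d * X + X * d + (p * X * p + q * X * q).
have ii x : 'i%C *: ('i%C *: x) = - x :> H.
  by rewrite scalerA -expr2 sqr_i scaleN1r.
(* The mixed terms cancel here and in [SXS], where S = 1 + p + A and S^-1 = 1 + p - A; the terms A X
   A cancel when the two are added. *)
have UVX : U * X * V + V * X * U = 2%:C *: (c * X * c + A * X * A).
  rewrite /U /V; move: (c) (A) => c' A'; bop_entries.
  rewrite ?(scalerN, scalerDr, opprD, opprK, bopD, bopN, bopZ).
  rewrite ?ii ?(rdotDr, rdotNr); lra.
have SXS : (1 - E) * X * Si + Si * X * (1 - E) =
    2%:C *: ((1 + p) * X * (1 + p) - A * X * A).
  rewrite /p /A; move: (1 - E) => S; bop_entries; lra.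
have id : 4%:C *: X =
    ((1 - E) * X * Si + Si * X * (1 - E) - 2%:C *: W) + (U * X * V + V * X * U).
  rewrite UVX SXS /W /d /c; move: (A) (p) => A' p'; bop_entries; lra.
have JD := ideal_cpr (1 - E) Si JX.
have JW : J W.
  apply: (idealD JN); apply: (idealD JN).
  - exact: ideal_mull.
  - exact: ideal_mulr.
  - exact: (idealM JN).
  - exact: (idealM JN).
have JUV : J (U * X * V) by exact: (idealM JN).
have JVU : J (V * X * U) by exact: (idealM JN).
have J2W : J (- (2%:C *: W)) by rewrite -scaleNr; exact: idealZ.
have N2W : N (- (2%:C *: W)) = 2 * N W.
  by rewrite -scaleNr (normZ JN)// normrN ger0_norm// ler0c.
have NUV : N (U * X * V) = N X by exact: (norm_unitary JN).
have NVU : N (V * X * U) = N X by exact: (norm_unitary JN).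
have h1 := normD JN (idealD JN JD J2W) (idealD JN JUV JVU).
have h2 := normD JN JD J2W; have h3 := normD JN JUV JVU.
rewrite -id ideal_realZ// in h1.
have p0 : 0 <= 2 / 3 * e ^+ 2 by lra.
have q0 : 0 <= 9 / 4 * e ^+ 2 by lra.
have d0 : 0 <= 3 * e ^+ 4 by lra.
have n1 := norm_selfadjoint_mull ad hd d0 JX.
have n2 := norm_selfadjoint_mulr ad hd d0 JX.
have sandwich b m : is_adjoint b b -> op_le m b -> 0 <= m ->
    N (b * X * b) <= m * (m * N X).
  move=> ab hb m0.
  apply: (le_trans (norm_selfadjoint_mulr ab hb m0 (ideal_mull _ JX))).
  by rewrite ler_wpM2l// norm_selfadjoint_mull.
have n3 := sandwich _ _ ap hp p0; have n4 := sandwich _ _ aq hq' q0.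
have JdX : J (d * X) by exact: ideal_mull.
have JXd : J (X * d) by exact: ideal_mulr.
have JpXp : J (p * X * p) by exact: (idealM JN).
have JqXq : J (q * X * q) by exact: (idealM JN).
have w1 := normD JN (idealD JN JdX JXd) (idealD JN JpXp JqXq).
have w2 := normD JN JdX JXd; have w3 := normD JN JpXp JqXq.
have e4E : e ^+ 4 = e ^+ 2 * e ^+ 2 by rewrite -exprD.
(* The terms contribute 3 + 3 + 4/9 + 81/16 < 12; twice this bound is the defect 24 e^4. *)
have : N W <= 12 * e ^+ 4 * N X.
  rewrite e4E in n1 n2 *.
  have : 0 <= e ^+ 2 * e ^+ 2 * N X by rewrite mulr_ge0// mulr_ge0.
  lra.
lra.
Qed.

(** Descent to the square root T = 1 - Y of S = 1 - E, with T^-1 = T S^-1; T commutes with S = T^2,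
    hence with S^-1. *)
Lemma sqrt_step E Si e : 0 <= e -> e < 1 -> op_le e E -> is_adjoint E E ->
  (1 - E) * Si = 1 -> Si * (1 - E) = 1 ->
  exists Y Ti : bop H, [/\ is_adjoint Y Y, op_le (e / (2 - e)) Y,
    (1 - Y) * Ti = 1 /\ Ti * (1 - Y) = 1, (1 - Y) * (1 - Y) = 1 - E
    & Ti * Ti = Si].
Proof.
move=> e0 e1 hE aE r l.
have [Y [aY hY YY _]] := sqrt_near1 e0 e1 hE aE.
exists Y, ((1 - Y) * Si); rewrite YY.
move: (1 - Y) (1 - E) YY r l => T S YY r l.
have comm : Si * T = T * Si.
  have ST : S * T = T * S by rewrite -YY mulrA.
  by rewrite -[LHS]mulr1 -r mulrA -(mulrA Si) -ST (mulrA Si) l mul1r.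
split=> //.
  by split; [rewrite mulrA YY|rewrite -comm -mulrA YY].
by rewrite mulrA -(mulrA T Si T) comm mulrA YY r mul1r.
Qed.

(** For e <= 1/4 a square root shrinks e by the factor 4/7 at least, and squaring back multiplies
    the defect by 4. As 4 (4/7)^4 = 1024/2401 < 1/2, each round halves the bound. *)
Lemma cpr_expanding_near1 k E Si e : 0 <= e -> e <= 4^-1 -> op_le e E ->
  is_adjoint E E -> (1 - E) * Si = 1 -> Si * (1 - E) = 1 ->
  cpr_expanding (24 * e ^+ 4 * 2^-1 ^+ k) (1 - E) Si.
Proof.
elim: k E Si e => [|k IH] E Si e e0 e4 hE aE r l.
  by rewrite expr0 mulr1; exact: cpr_expanding_base.
have [|Y [Ti [aY hY [r' l'] <- <-]]] := sqrt_step e0 _ hE aE r l; first lra.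
set e' := e / (2 - e) in hY.
have e'E : e' * (2 - e) = e by rewrite /e' divfK//; lra.
have e'0 : 0 <= e' by rewrite /e' divr_ge0//; lra.
have e'e : e' <= 4 / 7 * e by nra.
have d0 : 0 <= 24 * e' ^+ 4 * 2^-1 ^+ k.
  apply: mulr_ge0; last by apply: exprn_ge0; lra.
  by apply: mulr_ge0; [lra|exact: exprn_ge0].
have h := cpr_expanding_sqr r' l' d0
  (IH _ _ _ e'0 (ltac:(lra)) hY aY r' l').
move=> X JX; apply: le_trans (h X JX); rewrite ler_wpM2r ?(norm_ge0 JN)//.
rewrite lerB// (exprS _ k).
have e'4 : e' ^+ 4 <= 256 / 2401 * e ^+ 4.
  have <- : (4 / 7 * e) ^+ 4 = 256 / 2401 * e ^+ 4 by field.
  by rewrite lerXn2r// nnegrE//; lra.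
have k0 : 0 <= (2^-1 : R) ^+ k by rewrite exprn_ge0//; lra.
have : 4 * e' ^+ 4 <= e ^+ 4 * 2^-1.
  by have := exprn_ge0 4 e0; lra.
move=> /(ler_wpM2r k0); lra.
Qed.

Lemma cpr_expanding_quarter E Si e : 0 <= e -> e <= 4^-1 -> op_le e E ->
  is_adjoint E E -> (1 - E) * Si = 1 -> Si * (1 - E) = 1 ->
  cpr_expanding 0 (1 - E) Si.
Proof.
move=> e0 e4 hE aE r l X JX; rewrite -subr_le0.
apply: (@geometric_le0 _ _ (24 * e ^+ 4 * N X) 2^-1); [lra|lra|] => k.
by have := cpr_expanding_near1 k e0 e4 hE aE r l JX; lra.
Qed.

(* Passing to the square root replaces e by e' = e / (2 - e), so that
   1 / e' - 1 = 2 (1 / e - 1). *)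
Lemma cpr_expanding_exact k E Si e : 0 <= e -> e * (1 + 3 * 2^-1 ^+ k) <= 1 ->
  op_le e E -> is_adjoint E E -> (1 - E) * Si = 1 -> Si * (1 - E) = 1 ->
  cpr_expanding 0 (1 - E) Si.
Proof.
elim: k E Si e => [|k IH] E Si e e0 ek hE aE r l.
  by apply: (@cpr_expanding_quarter _ _ e) => //; rewrite expr0 in ek; lra.
have k0 : 0 < (2^-1 : R) ^+ k by rewrite exprn_gt0//; lra.
rewrite exprS in ek; have e1 : e < 1 by nra.
have [Y [Ti [aY hY [r' l'] <- <-]]] := sqrt_step e0 e1 hE aE r l.
set e' := e / (2 - e) in hY.
have e'E : e' * (2 - e) = e by rewrite /e' divfK//; lra.
have e'0 : 0 <= e' by rewrite /e' divr_ge0//; lra.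
rewrite -(mulr0 4); apply: cpr_expanding_sqr => //.
apply: (IH _ _ e') => //.
by rewrite /e' mulrAC ler_pdivrMr ?mul1r; lra.
Qed.

(** Since 3 e 2^-k tends to 0 and e < 1, finitely many square roots reach the range e <= 1/4. *)
Lemma cpr_expanding_lt1 E Si e : 0 <= e -> e < 1 -> op_le e E ->
  is_adjoint E E -> (1 - E) * Si = 1 -> Si * (1 - E) = 1 ->
  cpr_expanding 0 (1 - E) Si.
Proof.
move=> e0 e1 hE aE r l.
have [k hk] : exists k, e * (1 + 3 * 2^-1 ^+ k) <= 1.
  apply: contrapT => /forallNP h.
  suff : 1 - e <= 0 by lra.
  apply: (@geometric_le0 _ _ (3 * e) 2^-1); [lra|lra|] => k.
  by have /negP := h k; rewrite -ltNge; lra.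
exact: cpr_expanding_exact hk hE aE r l.
Qed.

End NormIdeal.

(* With T = |S| and U = S T^-1 unitary, D_S X = U (D_T X) U. *)
Lemma cpr_selfadjoint (R : realType) (H : hilbertType R) (J : set (bop H))
    (N : bop H -> R) (S Si : bop H) :
  ui_norm_ideal J N -> is_adjoint S S -> S * Si = 1 -> Si * S = 1 ->
  cpr_expanding J N 0 S Si.
Proof.
move=> JN aS r l.
have [b b0 hS] := op_leW S; have [m m0 hSi] := op_leW Si.
(* Scaling [S] leaves D_S unchanged and makes P a contraction with inverse Q. *)
pose P := b^-1%:C *: S; pose Q := b%:C *: Si.
have bi0 : 0 <= b^-1 by rewrite invr_ge0 ltW.
have PQ : P * Q = 1.
  rewrite /P /Q -bop_scalerAl -bop_scalerAr r scalerA -rmorphM.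
  by rewrite mulVf ?scale1r// gt_eqF.
have QP : Q * P = 1.
  rewrite /P /Q -bop_scalerAl -bop_scalerAr l scalerA -rmorphM.
  by rewrite divff ?scale1r// gt_eqF.
have aP : is_adjoint P P.
  by rewrite /P -[X in is_adjoint _ (X *: _)]conjc_real; exact: is_adjointZ.
have aQ := is_adjoint_inverse PQ QP aP.
have hP : op_le 1 P.
  have bn0 : b != 0 by rewrite gt_eqF.
  by rewrite -(mulVf bn0); exact: op_leZ.
(* The added 1 ensures k > 1, so that k^-2 < 1. *)
pose k := b * m + 1.
have bm0 : 0 < b * m by exact: mulr_gt0.
have hQ : op_le k Q.
  apply: (@op_le_trans _ _ (b * m)); first by rewrite /k lerDl.
  by apply: op_leZ => //; exact: ltW.
have k1 : 1 < k by rewrite /k ltrDr.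
have k0 : 0 < k by lra.
have ki0 : 0 < k^-1 by rewrite invr_gt0.
have ki1 : k^-1 < 1 by rewrite invf_lt1.
(* |x - P^2 x|^2 = |x|^2 - 2 |P x|^2 + |P^2 x|^2 <= |x|^2 - |P x|^2 <= (1 - k^-2) |x|^2. *)
pose e := Num.sqrt (1 - k^-1 ^+ 2).
have e0 : 0 <= e by exact: sqrtr_ge0.
have ee : e ^+ 2 = 1 - k^-1 ^+ 2 by rewrite sqr_sqrtr//; nra.
have e1 : e < 1 by nra.
have hE : op_le e (1 - P * P).
  move=> x; apply: le_of_sqr; first by rewrite mulr_ge0// rnorm_ge0.
  rewrite bop_addE bop_oppE bop_oneE bop_mulE rnorm_sqD rnormN rdotNr.
  rewrite -((is_adjointP _ _).1 aP) rdotxx exprMn ee.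
  have h1 : rnorm (P (P x)) ^+ 2 <= rnorm (P x) ^+ 2.
    rewrite lerXn2r ?nnegrE ?rnorm_ge0//.
    by have := hP (P x); rewrite mul1r.
  have h2 : (k^-1 * rnorm x) ^+ 2 <= rnorm (P x) ^+ 2.
    have : k^-1 * rnorm x <= rnorm (P x).
      by rewrite ler_pdivrMl//; have := hQ (P x); rewrite (bop_mulK QP).
    by apply: lerXn2r; rewrite nnegrE ?mulr_ge0 ?rnorm_ge0// ltW.
  by rewrite exprMn in h2; lra.
have aE : is_adjoint (1 - P * P) (1 - P * P).
  apply: is_adjointD; first exact: is_adjoint1.
  by apply: is_adjointN; exact: is_adjointM.
have [Y [aY hY]] := sqrt_near1 e0 e1 hE aE.
have -> : 1 - (1 - P * P) = P * P by rewrite opprB addrC subrK.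
move=> TT /(_ P) PY.
have aT : is_adjoint (1 - Y) (1 - Y).
  by apply: is_adjointD; [exact: is_adjoint1|exact: is_adjointN].
have PT : P * (1 - Y) = (1 - Y) * P.
  by rewrite mulrBr mulrBl mulr1 mul1r PY// mulrBr mulrBl mulr1 mul1r mulrA.
have e'0 : 0 <= e / (2 - e) by rewrite divr_ge0//; lra.
have e'1 : e / (2 - e) < 1 by rewrite ltr_pdivrMr; lra.
have h Ti := @cpr_expanding_lt1 _ _ _ _ JN _ Ti _ e'0 e'1 hY aY.
(* From here T is |P|, [T * Q] is the unitary sign of P, equal to its own inverse, and [T * Q * Q]
   is T^-1. *)
move: (1 - Y) TT aT PT h => T TT aT PT h.
have QT : Q * T = T * Q.
  by rewrite -[LHS]mulr1 -PQ mulrA -(mulrA Q) -PT (mulrA Q) QP mul1r.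
have TQTQ : T * Q * (T * Q) = 1.
  rewrite mulrA -(mulrA T Q T) QT mulrA TT.
  by rewrite -(mulrA P) PQ mulr1 PQ.
have uU : unitary (T * Q).
  apply: (unitary_intro _ TQTQ TQTQ).
  by rewrite -{2}QT; exact: is_adjointM.
have TTi : T * (T * Q * Q) = 1.
  by rewrite !mulrA TT -(mulrA P) PQ mulr1 PQ.
have TiT : T * Q * Q * T = 1.
  by rewrite -mulrA QT -(mulrA T) (mulrA Q) QT !mulrA TT -(mulrA P) PQ mulr1 PQ.
have UT : T * Q * T = P.
  by rewrite -mulrA QT mulrA TT -mulrA PQ mulr1.
have TU : T * (T * Q) = P by rewrite mulrA TT -mulrA PQ mulr1.
have UTi : T * Q * (T * Q * Q) = Q by rewrite mulrA TQTQ mul1r.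
have TiU : T * Q * Q * (T * Q) = Q by rewrite mulrA TiT mul1r.
move=> X JX; have hX := h _ TTi TiT X JX.
have -> : S * X * Si + Si * X * S = P * X * Q + Q * X * P.
  rewrite /P /Q -!(bop_scalerAl, bop_scalerAr) !scalerA -!rmorphM.
  by rewrite mulVf ?divff ?scale1r// gt_eqF.
have -> : P * X * Q + Q * X * P =
    T * Q * (T * X * (T * Q * Q) + T * Q * Q * X * T) * (T * Q).
  have -> : P * X * Q = T * Q * T * X * (T * Q * Q * (T * Q)).
    by rewrite UT TiU.
  have -> : Q * X * P = T * Q * (T * Q * Q) * X * (T * (T * Q)).
    by rewrite UTi TU.
  by rewrite !(mulrDr, mulrDl) !mulrA.
by rewrite (norm_unitary JN)//; exact: (ideal_cpr JN).
Qed.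

(** * Operators on the direct sum *)

Section Blocks.
Variables (R : realType) (H : hilbertType R).
Implicit Types (A B D E S X Y : bop H).

Lemma inverseE S T : S * T = 1 -> T * S = 1 -> inverse S = T.
Proof.
move=> r l; apply: xget_unique; first by split.
by move=> T' [r' l']; rewrite -[T']mul1r -l -mulrA r' mulr1.
Qed.

Lemma block_mul A B D E A' B' D' E' :
  block A B D E * block A' B' D' E' =
  block (A * A' + B * D') (A * B' + B * E') (D * A' + E * D') (D * B' + E * E').
Proof.
apply: bop_ext => -[x y]; congr pair => /=;
by rewrite !linearD addrACA.
Qed.

Lemma block_add A B D E A' B' D' E' :
  block A B D E + block A' B' D' E' =
  block (A + A') (B + B') (D + D') (E + E').
Proof. by apply: bop_ext => -[x y]; congr pair => /=; rewrite addrACA. Qed.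

Lemma block1 : block 1 0 0 1 = 1 :> bop (hsum H).
Proof. by apply: bop_ext => -[x y]; congr pair => /=; rewrite ?addr0 ?add0r. Qed.

Lemma is_adjoint_antidiag S T :
  is_adjoint S T -> is_adjoint (block 0 S T 0) (block 0 S T 0).
Proof.
move=> h; have h' := is_adjoint_sym h; case=> x y [z w].
rewrite -[LHS]/(hdot (0 + S y) z + hdot (T x + 0) w).
rewrite -[RHS]/(hdot x (0 + S w) + hdot y (T z + 0)).
by rewrite !add0r !addr0 h h' addrC.
Qed.

(** Exchanges the two summands; multiplication by it makes a diagonal block operator antidiagonal
    without changing the norm. *)
Definition swap : bop (hsum H) := block 0 1 1 0.

Lemma unitary_swap : unitary swap.
Proof.
have ss : swap * swap = 1.
  by rewrite block_mul !(mul0r, mulr0, mulr1, add0r, addr0) block1.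
by apply: (unitary_intro _ ss ss); exact: is_adjoint_antidiag.
Qed.

Lemma oplus_swap A B : oplus A B * swap = block 0 A B 0.
Proof. by rewrite block_mul !(mul0r, mulr0, mulr1, add0r, addr0). Qed.

Section InvertiblePair.
Variables (S Si : bop H).
Hypotheses (r : S * Si = 1) (l : Si * S = 1).

Let Sa := adjoint S.
Let Sia := adjoint Si.

Lemma adjoint_inverse_mul : Sa * Sia = 1 /\ Sia * Sa = 1.
Proof.
have h := adjointP S; have h' := adjointP Si.
split; [have g := is_adjointM h' h|have g := is_adjointM h h'];
  by apply: is_adjoint_uniq g _; rewrite ?l ?r; exact: is_adjoint1.
Qed.

(** The antidiagonal operator with entries S and its adjoint is self-adjoint even when S is not, and
    its inverse is again antidiagonal. *)
Lemma block_cpr (J : set (bop (hsum H))) (N : bop (hsum H) -> R) :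
  ui_norm_ideal J N -> forall Z, J Z ->
  2 * N Z <= N (block 0 S Sa 0 * Z * block 0 Sia Si 0 +
                block 0 Sia Si 0 * Z * block 0 S Sa 0).
Proof.
move=> JN Z JZ; have [r' l'] := adjoint_inverse_mul.
rewrite -[2]subr0; apply: (cpr_selfadjoint JN) => //.
- exact/is_adjoint_antidiag/adjointP.
- by rewrite block_mul !(mul0r, mulr0, add0r, addr0) r r' block1.
- by rewrite block_mul !(mul0r, mulr0, add0r, addr0) l l' block1.
Qed.

Lemma oplus_cpr X Y :
  block 0 S Sa 0 * oplus X Y * block 0 Sia Si 0 +
  block 0 Sia Si 0 * oplus X Y * block 0 S Sa 0 =
  oplus (S * Y * Si + Sia * Y * Sa) (Sa * X * Sia + Si * X * S).
Proof.
by rewrite !block_mul block_add !(mul0r, mulr0, add0r, addr0).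
Qed.

(** Putting X and Y off the diagonal pairs S with the inverse of its adjoint, as in (ii). *)
Lemma antidiag_cpr X Y :
  block 0 S Sa 0 * block 0 X Y 0 * block 0 Sia Si 0 +
  block 0 Sia Si 0 * block 0 X Y 0 * block 0 S Sa 0 =
  block 0 (S * Y * Sia + Sia * Y * S) (Sa * X * Si + Si * X * Sa) 0.
Proof.
by rewrite !block_mul block_add !(mul0r, mulr0, add0r, addr0).
Qed.

End InvertiblePair.
End Blocks.

(** * The three inequalities *)

Section Main.
Variables (R : realType) (H : hilbertType R).

Lemma block_ideal_oplus (J : set (bop H)) A B :
  J 0 -> J A -> J B -> block_ideal J (oplus A B).
Proof. by move=> J0 JA JB; exists A, 0, 0, B. Qed.

Lemma inverse_adjoint (S Si : bop H) : S * Si = 1 -> Si * S = 1 ->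
  inverse (adjoint S) = adjoint Si.
Proof. by move=> r l; have [] := adjoint_inverse_mul r l; exact: inverseE. Qed.

Lemma corach_porta_recht_holds : corach_porta_recht H.
Proof.
move=> N S X [Si [r l]] /selfadjoint_is_adjoint aS JX.
rewrite (inverseE r l) -[leLHS](congr1 (fun c => c * _) (subr0 2)).
exact: (cpr_selfadjoint (uiP N)).
Qed.

Lemma inequality_i_holds : inequality_i H.
Proof.
move=> N S X Y [Si [r l]] JX JY.
rewrite (inverse_adjoint r l) (inverseE r l) -oplus_cpr.
apply: (block_cpr r l (uiP_sum N)).
exact: block_ideal_oplus (ideal0 (uiP N)) JX JY.
Qed.

Lemma inequality_ii_holds : inequality_ii H.
Proof.
move=> N S X Y [Si [r l]] JX JY.
have J0 := ideal0 (uiP N).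
rewrite (inverse_adjoint r l) (inverseE r l).
have JXY := block_ideal_oplus J0 JX JY.
set A := _ + _; set B := _ + _.
have JA : ui_ideal N A by apply: (idealD (uiP N)); exact: (idealM (uiP N)).
have JB : ui_ideal N B by apply: (idealD (uiP N)); exact: (idealM (uiP N)).
have JAB := block_ideal_oplus J0 JA JB.
have uS := unitary_swap H.
(* Both sides are multiplied by the unitary [swap] to reach the antidiagonal form. *)
rewrite -(norm_mul_unitaryr (uiP_sum N) uS JXY).
rewrite -(norm_mul_unitaryr (uiP_sum N) uS JAB) !oplus_swap.
rewrite /A /B -antidiag_cpr -oplus_swap.
apply: (block_cpr r l (uiP_sum N)); exact: (ideal_mulr (uiP_sum N)).
Qed.

End Main.

Theorem theorem2p10 (R : realType) (H : hilbertType R) :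
  [/\ inequality_i H,
      inequality_ii H,
      (inequality_i H <-> corach_porta_recht H) &
      (inequality_ii H <-> corach_porta_recht H)].
Proof.
have hi := @inequality_i_holds R H; have hii := @inequality_ii_holds R H.
by have hc := @corach_porta_recht_holds R H; split.
Qed.
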